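(* Let $r\in[1,\infty)$. The mapping $$\Phi:\left(\mathrm{Diff}_0(S^1),F\right)\to\left(C^\infty(S^1),L^r\right),\qquad \varphi\mapsto r\,\varphi_x^{1/r}$$ is an isometric embedding. Furthermore, the image $\mathcal U=\Phi(\mathrm{Diff}_0(S^1))$ is an open subset of the $L^r$-sphere of radius $r$, given by $$\mathcal U=\{f\in C^\infty(S^1): f>0,\ \|f\|_{L^r}=r\}.$$ The inverse of $\Phi$ is given by $$\Phi^{-1}:\mathcal U\to\mathrm{Diff}_0(S^1),\qquad f\mapsto\left(x\mapsto\frac1{r^r}\int_0^x|f(\tilde x)|^r\,d\tilde x\right).$$
   Context: The circle $S^1$ is identified with the interval $[0,1]$ (endpoints identified). $\mathrm{Diff}(S^1)=\{\varphi\in C^\infty(S^1,S^1): \varphi'>0,\ \varphi^{-1}\in C^\infty(S^1,S^1)\}$ is the Fréchet Lie group of smooth orientation preserving diffeomorphisms, and $\mathrm{Diff}_0(S^1)=\{\varphi\in\mathrm{Diff}(S^1):\varphi(0)=0\}$, which is identified with $\mathrm{Rot}\backslash\mathrm{Diff}(S^1)$ (diffeomorphisms modulo rotations); its Lie algebra is $C_0^\infty(S^1)=\{u\in C^\infty(S^1):u(0)=0\}$. The right-invariant homogeneous $W^{1,r}$-Finsler metric on $\mathrm{Diff}_0(S^1)$ is, for a tangent vector $h=X\circ\varphi$ at $\varphi$ with $X\in C_0^\infty(S^1)$, $$F_\varphi(h)=\left(\int_{S^1}|(h\circ\varphi^{-1})'|^r\,dx\right)^{1/r}=\left(\int_{S^1}|X'|^r\,dx\right)^{1/r}.$$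 The space $C^\infty(S^1)$ carries the (footpoint independent) Finsler metric given by the $L^r$-norm; the $L^r$-sphere of radius $r$ is $\{f\in C^\infty(S^1):\|f\|_{L^r}=r\}$, and openness is with respect to the $C^\infty$ topology. ''Isometric'' means that the differential of $\Phi$ preserves the Finsler norms: $\|D_{\varphi,h}\Phi\|_{L^r}=F_\varphi(h)$ for all $\varphi$ and all tangent vectors $h$ at $\varphi$, where $D_{\varphi,h}\Phi$ is the derivative of $\Phi$ at $\varphi$ in direction $h$. *)

(* Defs.v *)
From HB Require Import structures.
From mathcomp Require Import all_boot all_order all_algebra.
From mathcomp Require Import all_classical all_reals all_analysis.

Set Implicit Arguments.
Unset Strict Implicit.
Unset Printing Implicit Defensive.

Import Order.TTheory GRing.Theory Num.Theory.
Import numFieldNormedType.Exports.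

Local Open Scope ring_scope.
Local Open Scope classical_set_scope.

(* The circle is R/Z: a function on it is a 1-periodic function on the line,
   and a circle map fixing 0 is represented by its unique lift R -> R fixing
   0. *)

Definition jets (R : realType) (f : R -> R) :
  {ptws nat -> {uniform R -> R}} := fun n => f^`(n).

(* The vector space R -> R with the topology of uniform convergence of all
   derivatives. [derive1n] is a total operator, so this is meaningful only on
   smooth functions: the topology is always traced on a set of such functions
   ([Cinf] or [Diff0] below), where it is the usual C^infty topology. *)
Definition cinf_top (R : realType) : Type := initial_topology (@jets R).

HB.instance Definition _ (R : realType) :=
  Topological.copy (cinf_top R) (initial_topology (@jets R)).
HB.instance Definition _ (R : realType) :=
  GRing.Lmodule.copy (cinf_top R) (R -> R^o).

Definition smooth (R : realType) (f : R -> R) : Prop :=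
  forall n x, derivable (f^`(n)) x 1.

Definition Cinf (R : realType) : set (cinf_top R) :=
  [set f | smooth f /\ forall x : R, f (x + 1) = f x].

Definition Cinf0 (R : realType) : set (cinf_top R) :=
  [set u | Cinf u /\ u 0 = 0].

Definition Diff (R : realType) : set (cinf_top R) :=
  [set phi | [/\ smooth phi,
                 forall x : R, phi (x + 1) = phi x + 1,
                 forall x : R, 0 < derive1 (phi : R -> R) x &
                 exists psi : R -> R,
                   [/\ smooth psi, cancel phi psi & cancel psi phi]]].

Definition Diff0 (R : realType) : set (cinf_top R) :=
  [set phi | Diff phi /\ phi 0 = 0].

Definition tangent (R : realType) (phi : cinf_top R) : set (cinf_top R) :=
  [set h | exists2 X, Cinf0 X & h = X \o phi].

Definition Lr_norm (R : realType) (r : R) (f : R -> R) : R :=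
  (\int[lebesgue_measure]_(x in `[0%R, 1%R]) (`|f x| `^ r)) `^ r^-1.

(* [pinv setT phi] is the inverse diffeomorphism when [phi] is in [Diff]. *)
Definition finsler (R : realType) (r : R) (phi h : R -> R) : R :=
  Lr_norm r (derive1 (h \o pinv setT phi)).

Definition has_dderiv (R : realType) (f : cinf_top R -> cinf_top R)
    (x h g : cinf_top R) : Prop :=
  (t^-1 *: (f (x + t *: h) - f x)) @[t --> (0 : R)^'] --> g.

(* C^infty maps between Frechet spaces, in the usual (Michal-Bastiani,
   Hamilton) sense: all iterated directional derivatives [D k x h] exist and
   are jointly continuous in the foot point and the [k] directions.  The domain
   [A] is open in an affine space with direction [H]; [F] is the target vector
   space.  The values of [f] off [A] are irrelevant, as [x + t *: h] stays in
   [A] for small [t]. *)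
Definition smooth_map (R : realType) (A H F : set (cinf_top R))
    (f : cinf_top R -> cinf_top R) : Prop :=
  exists D : forall k : nat,
      cinf_top R -> {ptws 'I_k -> cinf_top R} -> cinf_top R,
  [/\ forall x h, A x -> D 0 x h = f x,
      forall k x h, A x -> (forall i, H (h i)) -> F (D k x h),
      forall k x (h : {ptws 'I_k.+1 -> cinf_top R}), A x ->
        (forall i, H (h i)) ->
        has_dderiv (fun y => D k y (fun i => h (lift ord0 i)))
          x (h ord0) (D k.+1 x h) &
      forall k, {within A `*` [set h : {ptws 'I_k -> cinf_top R} | forall i, H (h i)],
        continuous (fun p : cinf_top R * {ptws 'I_k -> cinf_top R} =>
          D k p.1 p.2)}].

(* The last clause: [f] maps relatively open sets of [A] to relatively open
   sets of [f @` A]; with the continuity contained in [smooth_map], [f] is a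
   homeomorphism onto its image. *)
Definition smooth_embedding (R : realType) (A H F : set (cinf_top R))
    (f : cinf_top R -> cinf_top R) : Prop :=
  [/\ smooth_map A H F f,
      set_inj A f,
      forall x h, A x -> H h -> has_dderiv f x h 0 -> h = 0 &
      forall O : set (cinf_top R), open O ->
        exists2 O' : set (cinf_top R), open O' &
          f @` (A `&` O) = f @` A `&` O'].

Definition isometric (R : realType) (r : R)
    (f : cinf_top R -> cinf_top R) : Prop :=
  forall phi h, Diff0 phi -> tangent phi h ->
    exists2 g, has_dderiv f phi h g & Lr_norm r g = finsler r phi h.

Definition Phi (R : realType) (r : R) (phi : cinf_top R) : cinf_top R :=
  fun x : R => r * (derive1 (phi : R -> R) x) `^ r^-1.

Definition Lr_sphere (R : realType) (r rho : R) : set (cinf_top R) :=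
  [set f | Cinf f /\ Lr_norm r f = rho].

Definition integral0 (R : realType) (f : R -> R) (x : R) : R :=
  if 0 <= x then \int[lebesgue_measure]_(t in `[0%R, x]) f t
  else - \int[lebesgue_measure]_(t in `[x, 0%R]) f t.

(* On [0, 1] this is the stated formula; the oriented integral extends it to
   the lift on the whole line. *)
Definition Phi_inv (R : realType) (r : R) (f : cinf_top R) : cinf_top R :=
  fun x : R => (r `^ r)^-1 * integral0 (fun t => `|f t| `^ r) x.

(* Main.v *)
(* With f = Phi(phi) = r phi'^(1/r) one has f^r = r^r phi', so phi is recovered
   from f by integration and ||f||_{L^r} = r says phi(1) - phi(0) = 1; conversely
   a positive periodic f with this norm integrates to a lift with positive
   derivative, i.e. to a diffeomorphism. For h = X o phi the derivative of Phi
   is phi'^(1/r - 1) h' = (X' o phi) phi'^(1/r), whose L^r norm is that of X' by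
   the change of variable phi. The k-th differential of Phi is
   r (1/r)(1/r - 1)...(1/r - k + 1) phi'^(1/r - k) h_1' ... h_k', so the
   smoothness statements reduce to that of p |-> p^a on positive periodic
   functions. *)
Require Import Defs.
From mathcomp Require Import all_boot all_order all_algebra.
From mathcomp Require Import all_classical all_reals all_analysis.
From mathcomp Require Import ring lra.

Set Implicit Arguments.
Unset Strict Implicit.
Unset Printing Implicit Defensive.

Import Order.TTheory GRing.Theory Num.Theory.
Import numFieldNormedType.Exports.

Local Open Scope ring_scope.
Local Open Scope classical_set_scope.

(** A lift phi is not periodic, but phi' is, so the compactness of the circle acts through phi',
    where it gives bounds 0 < m <= phi' <= M. On [m, M] a real power satisfies a Lipschitz bound and
    a Taylor bound with quadratic remainder; these two estimates of order 0 carry the whole smooth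
    calculus. The price is paid for the inverse: convergence of the derivatives has to be turned
    back into convergence of the lifts themselves, which uses phi(0) = 0 and the periodicity of the
    difference of two lifts. Pointwise positivity is not an open condition among all functions on
    the line. On periodic functions it amounts to a uniform positive lower bound, which is open, and
    this is how the image becomes open in the sphere. Uniqueness of the primitive vanishing at 0
    serves twice: it recovers phi from Phi(phi), and it replaces a change of variables theorem in
    the isometry. *)

(** * Smooth functions on the line *)

Lemma derive1_is_derive (R : realType) (f df : R -> R) :
  (forall x : R, is_derive x 1 f (df x)) -> f^`() = df.
Proof.
by move=> fdf; apply/funext => x; rewrite derive1E; apply: derive_val.
Qed.

Lemma smooth_is_derive (R : realType) (f : R -> R) (x : R) :
  smooth f -> is_derive x 1 f (f^`() x).
Proof. by move=> sf; apply: DeriveDef; [exact: (sf 0) | rewrite derive1E]. Qed.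

Lemma smooth_derive1 (R : realType) (f : R -> R) : smooth f -> smooth f^`().
Proof. by move=> sf n x; rewrite -derive1Sn; exact: sf. Qed.

Lemma smooth_cst (R : realType) (c : R) : smooth (fun=> c).
Proof.
have d0 k : (fun=> k : R)^`() = (fun=> 0 : R).
  by apply: derive1_is_derive => x; exact: is_derive_cst.
move=> n x; suff [k ->] : exists k, (fun=> c)^`(n) = (fun=> k : R).
  exact: derivable_cst.
by elim: n => [|n [k IH]]; [exists c | exists 0; rewrite derive1nS IH d0].
Qed.

(* This class is stable under differentiation, which makes all its members
   smooth without any Leibniz or Faa di Bruno formula. *)
Inductive smooth_closure (R : realType) : (R -> R) -> Prop :=
| SmoothBase f of smooth f : smooth_closure f
| SmoothAdd f g of smooth_closure f & smooth_closure g :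
    smooth_closure (fun x => f x + g x)
| SmoothMul f g of smooth_closure f & smooth_closure g :
    smooth_closure (fun x => f x * g x)
| SmoothComp f g of smooth_closure f & smooth_closure g :
    smooth_closure (fun x => f (g x))
| SmoothPow f a of smooth_closure f & (forall x, 0 < f x) :
    smooth_closure (fun x => f x `^ a)
| SmoothInv f g of smooth_closure f & cancel f g & cancel g f &
    (forall x, 0 < f^`() x) : smooth_closure g.

Lemma is_derive_powR_comp (R : realType) (f : R -> R) (a x df : R) :
  0 < f x -> is_derive x 1 f df ->
  is_derive x 1 (fun y => f y `^ a) (a * f x `^ (a - 1) * df).
Proof.
move=> fx0 dfx; have dp := is_derive1_powR a fx0.
have := is_derive1_comp dp dfx.
by rewrite /comp /GRing.scale /= mulrC.
Qed.

Lemma smooth_closure_derive (R : realType) (f : R -> R) : smooth_closure f ->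
  exists2 df, smooth_closure df & forall x : R, is_derive x 1 f (df x).
Proof.
elim=> {f} [f sf|f g _ [df sdf fP] _ [dg sdg gP]|
  f g sf [df sdf fP] sg [dg sdg gP]|f g sf [df sdf fP] sg [dg sdg gP]|
  f a sf [df sdf fP] f0|f g sf [df sdf fP] fK gK f0].
- exists f^`(); first by apply: SmoothBase; exact: smooth_derive1.
  by move=> x; exact: smooth_is_derive.
- exists (fun x => df x + dg x); first exact: SmoothAdd.
  by move=> x; exact: is_deriveD.
- exists (fun x => f x * dg x + g x * df x).
    by apply: SmoothAdd; exact: SmoothMul.
  by move=> x; exact: is_deriveM.
- exists (fun x => df (g x) * dg x).
    by apply: SmoothMul => //; exact: SmoothComp.
  move=> x; have := is_derive1_comp (fP (g x)) (gP x).
  by rewrite /comp mulrC.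
- exists (fun x => a * f x `^ (a - 1) * df x).
    apply: SmoothMul => //; apply: SmoothMul; last exact: SmoothPow.
    by apply: SmoothBase; exact: smooth_cst.
  by move=> x; exact: is_derive_powR_comp.
- have dfE := derive1_is_derive fP; rewrite dfE in f0.
  (* The derivative 1 / f'(g x) of the inverse is written as a power with exponent -1, so that it
     stays in the class through [SmoothPow] and [SmoothComp]; positivity of f' is what allows
     this. *)
  exists (fun x => df (g x) `^ (-1)).
    apply: (@SmoothComp _ (fun x => df x `^ (-1)) g); first exact: SmoothPow.
    by apply: (SmoothInv sf) => //; rewrite dfE.
  move=> x; rewrite -{1}[x]gK powRN powRr1 ?ltW//.
  apply: (@is_derive_inverse _ f).
  - by near=> y; rewrite fK.
  - near=> y; apply/differentiable_continuous/derivable1_diffP.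
    by have [] := fP y.
  - exact: lt0r_neq0.
Unshelve. all: by end_near.
Qed.

Lemma smooth_closure_smooth (R : realType) (f : R -> R) :
  smooth_closure f -> smooth f.
Proof.
move=> sf n; elim: n f sf => [|n IH] f /smooth_closure_derive[df sdf fP] x.
  by have [] := fP x.
by rewrite derive1Sn (derive1_is_derive fP); exact: IH.
Qed.

Lemma smoothD (R : realType) (f g : R -> R) :
  smooth f -> smooth g -> smooth (fun x => f x + g x).
Proof.
move=> sf sg; apply: smooth_closure_smooth.
by apply: SmoothAdd; exact: SmoothBase.
Qed.

Lemma smoothM (R : realType) (f g : R -> R) :
  smooth f -> smooth g -> smooth (fun x => f x * g x).
Proof.
move=> sf sg; apply: smooth_closure_smooth.
by apply: SmoothMul; exact: SmoothBase.
Qed.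

Lemma smooth_comp (R : realType) (f g : R -> R) :
  smooth f -> smooth g -> smooth (fun x => f (g x)).
Proof.
move=> sf sg; apply: smooth_closure_smooth.
by apply: SmoothComp; exact: SmoothBase.
Qed.

Lemma smooth_powR (R : realType) (f : R -> R) (a : R) :
  smooth f -> (forall x, 0 < f x) -> smooth (fun x => f x `^ a).
Proof.
move=> sf f0; apply: smooth_closure_smooth.
by apply: SmoothPow => //; exact: SmoothBase.
Qed.

Lemma smooth_inverse (R : realType) (f g : R -> R) :
  smooth f -> cancel f g -> cancel g f -> (forall x, 0 < f^`() x) -> smooth g.
Proof.
move=> sf fK gK f0; apply: smooth_closure_smooth.
by apply: (@SmoothInv _ f) => //; exact: SmoothBase.
Qed.

Lemma smooth_continuous (R : realType) (f : R -> R) : smooth f -> continuous f.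
Proof.
by move=> sf x; apply/differentiable_continuous/derivable1_diffP/(sf 0).
Qed.

(** * Periodic smooth functions and their bounds *)

(** The constant [c] cancels in difference quotients. The case c = 0 serves periodic functions, the
    case c = 1 lifts of circle maps. *)
Lemma derive1_shift1 (R : realType) (f : R -> R) (c : R) :
  (forall x, f (x + 1) = f x + c) -> forall x, f^`() (x + 1) = f^`() x.
Proof.
move=> fp x; rewrite /derive1.
suff -> : (fun h : R => h^-1 *: (f (h + (x + 1)) - f (x + 1))) =
          (fun h => h^-1 *: (f (h + x) - f x)) by [].
by apply/funext => h; rewrite addrA !fp opprD addrACA subrr addr0.
Qed.

Lemma Cinf_derive1 (R : realType) (f : R -> R) : Cinf f -> Cinf f^`().
Proof.
move=> [sf fp]; split; first exact: smooth_derive1.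
by apply: (@derive1_shift1 _ _ 0) => x; rewrite addr0.
Qed.

Lemma CinfD (R : realType) (f g : R -> R) :
  Cinf f -> Cinf g -> Cinf (fun x => f x + g x).
Proof.
by move=> [sf fp] [sg gp]; split => [|x]; [exact: smoothD | rewrite fp gp].
Qed.

Lemma CinfM (R : realType) (f g : R -> R) :
  Cinf f -> Cinf g -> Cinf (fun x => f x * g x).
Proof.
by move=> [sf fp] [sg gp]; split => [|x]; [exact: smoothM | rewrite fp gp].
Qed.

Lemma Cinf_cst (R : realType) (c : R) : Cinf (fun _ : R => c).
Proof. by split => //; exact: smooth_cst. Qed.

Lemma Cinf_powR (R : realType) (f : R -> R) (a : R) :
  Cinf f -> (forall x, 0 < f x) -> Cinf (fun x => f x `^ a).
Proof.
by move=> [sf fp] f0; split => [|x]; [exact: smooth_powR | rewrite fp].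
Qed.

Lemma periodic_fundamental (R : realType) (f : R -> R) :
  (forall x, f (x + 1) = f x) ->
  forall x, exists2 y, y \in `[0, 1]%R & f x = f y.
Proof.
move=> fp x.
have fpn n y : f (y + n%:R) = f y.
  by elim: n => [|n IH]; rewrite ?addr0// -natr1 addrA fp.
exists (x - (Num.floor x)%:~R).
  have := floor_le_tmp x; have := floorD1_gt x; rewrite intrD in_itv /= => ? ?.
  by apply/andP; split; lra.
case: (Num.floor x) => n; first by rewrite -[in LHS](subrK n%:R x) fpn.
by rewrite NegzE mulrNz opprK fpn.
Qed.

(** Compactness of the circle: the extrema on [0, 1] are global by periodicity. *)
Lemma Cinf_segment (R : realType) (f : R -> R) : Cinf f ->
  exists a b, forall x, f a <= f x <= f b.
Proof.
move=> [sf fp]; have cf : {within `[0, 1], continuous f}.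
  exact/continuous_subspaceT/smooth_continuous.
have [b _ fb] := EVT_max ler01 cf; have [a _ fa] := EVT_min ler01 cf.
exists a, b => x; have [y y01 ->] := periodic_fundamental fp x.
by rewrite fa ?fb.
Qed.

Lemma Cinf_bounded (R : realType) (f : R -> R) : Cinf f ->
  exists2 M : R, 0 < M & forall x, `|f x| <= M.
Proof.
move=> /Cinf_segment[a [b fab]]; exists (`|f a| + `|f b| + 1).
  by rewrite ltr_pwDr// addr_ge0.
move=> x; have /andP[fax fxb] := fab x; rewrite ler_norml.
have := ler_norm (f b); have := ler_norm (- f a); rewrite normrN.
have := normr_ge0 (f a); have := normr_ge0 (f b) => *.
by apply/andP; split; lra.
Qed.

Lemma Cinf_lower_bound (R : realType) (f : R -> R) : Cinf f ->
  (forall x, 0 < f x) -> exists2 c : R, 0 < c & forall x, c <= f x.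
Proof.
by move=> /Cinf_segment[a [b fab]] f0; exists (f a) => // x; case/andP: (fab x).
Qed.

(** * Estimates for real powers away from 0 *)

(** The mean value theorem for either order of [z] and [w]. The bound on [c - w] is kept because the
    quadratic remainder in [powR_taylor1] compares the derivative at [c] with the one at [w]. *)
Lemma powR_MVT (R : realType) (a m M z w : R) : 0 < m ->
  m <= z <= M -> m <= w <= M ->
  exists2 c, m <= c <= M /\ `|c - w| <= `|z - w| &
    z `^ a - w `^ a = a * c `^ (a - 1) * (z - w).
Proof.
move=> m0.
have key x y : m <= x <= M -> m <= y <= M -> x <= y ->
    exists2 c, x <= c <= y & y `^ a - x `^ a = a * c `^ (a - 1) * (y - x).
  move=> /andP[mx xM] /andP[my yM] xy.
  have dp t : m <= t -> is_derive t 1 (@powR R ^~ a) (a * t `^ (a - 1)).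
    by move=> mt; apply: is_derive1_powR; exact: lt_le_trans mt.
  have [|t|c cxy E] := @MVT_segment R (@powR R ^~ a)
      (fun t => a * t `^ (a - 1)) x y xy.
  - by move=> t; rewrite in_itv /= => /andP[/ltW xt _]; apply/dp/(le_trans mx).
  - apply: continuous_in_subspaceT t => t; rewrite inE /= in_itv /= => /andP[xt _].
    apply/differentiable_continuous/derivable1_diffP.
    by have [] := dp t (le_trans mx xt).
  - by exists c.
move=> mz mw; case: (lerP z w) => [zw|/ltW wz].
- have [c /andP[zc cw] E] := key _ _ mz mw zw; exists c.
    case/andP: mz => ? ?; case/andP: mw => ? ?; split; first by
      apply/andP; split; lra.
    by rewrite !ler0_norm; lra.
  by rewrite -opprB E -mulrN opprB.
- have [c /andP[zc cw] E] := key _ _ mw mz wz; exists c => //.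
  case/andP: mz => ? ?; case/andP: mw => ? ?; split; first by
      apply/andP; split; lra.
  by rewrite !ger0_norm; lra.
Qed.

Lemma powR_bounded (R : realType) (a m M : R) : 0 < m ->
  exists2 K : R, 0 < K & forall c, m <= c <= M -> c `^ a <= K.
Proof.
(* The power is monotone, in a direction depending on the sign of [a]: the term in [M] dominates for
   a >= 0 and the term in [m] for a < 0, so the sum covers both. *)
move=> m0; exists (m `^ a + M `^ a); first by rewrite ltr_wpDr ?powR_ge0 ?powR_gt0.
move=> c /andP[mc cM]; have c0 := lt_le_trans m0 mc.
case: (lerP 0 a) => a0.
  by rewrite ler_wpDl ?powR_ge0// ge0_ler_powR ?nnegrE// ?ltW ?(lt_le_trans c0).
rewrite ler_wpDr ?powR_ge0// -(opprK a) !(powRN _ (- a)).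
rewrite lef_pV2 ?posrE ?powR_gt0//.
by rewrite ge0_ler_powR ?nnegrE// ?ltW// oppr_gt0.
Qed.

Lemma powR_lipschitz (R : realType) (a m M : R) : 0 < m ->
  exists2 K : R, 0 < K & forall z w, m <= z <= M -> m <= w <= M ->
    `|z `^ a - w `^ a| <= K * `|z - w|.
Proof.
move=> m0; have [K K0 KP] := @powR_bounded R (a - 1) m M m0.
exists (`|a| * K + 1) => [|z w mz mw]; first by rewrite ltr_pwDr// mulr_ge0// ltW.
have [c [mcM _] ->] := powR_MVT a m0 mz mw.
rewrite normrM ler_wpM2r// normrM ler_wpDr// ler_wpM2l//.
by rewrite ger0_norm ?powR_ge0// KP.
Qed.

Lemma powR_taylor1 (R : realType) (a m M : R) : 0 < m ->
  exists2 K : R, 0 < K & forall z w, m <= z <= M -> m <= w <= M ->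
    `|z `^ a - w `^ a - a * w `^ (a - 1) * (z - w)| <= K * `|z - w| ^+ 2.
Proof.
move=> m0; have [K K0 KP] := @powR_lipschitz R (a - 1) m M m0.
exists (`|a| * K + 1) => [|z w mz mw]; first by rewrite ltr_pwDr// mulr_ge0// ltW.
have [c [mcM czw] ->] := powR_MVT a m0 mz mw.
rewrite -mulrBl -mulrBr !normrM expr2 mulrA ler_wpM2r//.
rewrite mulrDl ler_wpDr ?mul1r// -mulrA ler_wpM2l//.
by rewrite (le_trans (KP _ _ mcM mw))// ler_wpM2l// ltW.
Qed.

(** * Uniform and smooth convergence of families *)

Definition ucvg (R : realType) (T : Type) (F : set_system T)
    (u : T -> R -> R) (f : R -> R) : Prop :=
  forall e, 0 < e -> \forall t \near F, forall x, `|f x - u t x| <= e.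

Section UniformConvergence.
Context {R : realType} {T : Type} (F : set_system T) {FF : Filter F}.
Implicit Types (u v : T -> R -> R) (f g p q : R -> R).

Lemma ucvg_near_eq u v f :
  (\forall t \near F, u t = v t) -> ucvg F u f -> ucvg F v f.
Proof. by move=> uv uf e e0; apply: filterS2 uv (uf e e0) => t ->. Qed.

Lemma ucvg_cst (tau : T -> R) (l : R) :
  tau @ F --> l -> ucvg F (fun t => fun=> tau t) (fun=> l).
Proof. by move=> /cvgrPdist_le tl e e0; apply: filterS (tl e e0). Qed.

Lemma ucvgD u v f g : ucvg F u f -> ucvg F v g ->
  ucvg F (fun t x => u t x + v t x) (fun x => f x + g x).
Proof.
move=> uf vg e e0; have e20 : 0 < e / 2 by rewrite divr_gt0.
apply: filterS2 (uf _ e20) (vg _ e20) => t ut vt x.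
rewrite opprD addrACA (le_trans (ler_normD _ _))//.
by rewrite (splitr e) lerD.
Qed.

Lemma ucvgM u v f g (M N : R) : 0 < M -> 0 < N ->
  (forall x, `|f x| <= M) -> (forall x, `|g x| <= N) ->
  ucvg F u f -> ucvg F v g ->
  ucvg F (fun t x => u t x * v t x) (fun x => f x * g x).
Proof.
move=> M0 N0 fM gN uf vg e e0.
(* If both factors are within d of their limits, the product is within d M + d N + d^2 of its limit.
   The bound d <= 1 turns d^2 into d, and the total is at most d (M + N + 1) <= e. *)
pose d := Num.min 1 (e / (M + N + 1)).
have MN0 : 0 < M + N + 1 by rewrite !addr_gt0.
have d0 : 0 < d by rewrite lt_min ltr01 divr_gt0.
have d1 : d <= 1 by rewrite ge_min lexx.
have de : d * M + d * N + d <= e.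
  by rewrite -{3}(mulr1 d) -!mulrDr -ler_pdivlMr// ge_min lexx orbT.
apply: filterS2 (uf _ d0) (vg _ d0) => t ut vt x.
have -> : f x * g x - u t x * v t x =
   f x * (g x - v t x) + (f x - u t x) * g x - (f x - u t x) * (g x - v t x).
  by ring.
apply: le_trans de.
apply: (le_trans (ler_normB _ _)); apply: lerD.
  apply: (le_trans (ler_normD _ _)); rewrite !normrM lerD//.
    by rewrite mulrC ler_pM.
  by rewrite ler_pM.
by rewrite normrM -[leRHS]mulr1 ler_pM// (le_trans (vt x)).
Qed.

Lemma ucvg_ge u f (c d : R) : d < c -> (forall x, c <= f x) -> ucvg F u f ->
  \forall t \near F, forall x, d <= u t x.
Proof.
move=> dc cf uf; have cd0 : 0 < c - d by rewrite subr_gt0.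
apply: filterS (uf _ cd0) => t ut x.
by have := ler_norm (f x - u t x); have := ut x; have := cf x; lra.
Qed.

Lemma ucvg_le u f (M N : R) : M < N -> (forall x, f x <= M) -> ucvg F u f ->
  \forall t \near F, forall x, u t x <= N.
Proof.
move=> MN fM uf; have cd0 : 0 < N - M by rewrite subr_gt0.
apply: filterS (uf _ cd0) => t ut x.
have := ler_norm (- (f x - u t x)); rewrite normrN.
by have := ut x; have := fM x; lra.
Qed.

(** Halving [c] and adding 1 to [M] leaves room for the perturbation, so one interval away from 0,
    hence one Lipschitz or Taylor constant, serves the limit and its neighbours. *)
Lemma ucvg_segment u f (c M : R) : 0 < c -> (forall x, c <= f x <= M) ->
  ucvg F u f -> \forall t \near F, forall x, c / 2 <= u t x <= M + 1.
Proof.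
move=> c0 fcM uf.
have : \forall t \near F, forall x, c / 2 <= u t x.
  by apply: (@ucvg_ge u f c) => // [|x]; [lra | case/andP: (fcM x)].
have : \forall t \near F, forall x, u t x <= M + 1.
  by apply: (@ucvg_le u f M) => // [|x]; [lra | case/andP: (fcM x)].
by apply: filterS2 => t uM uc x; rewrite uM uc.
Qed.

Lemma ucvg_powR u f (a c M : R) : 0 < c -> (forall x, c <= f x <= M) ->
  ucvg F u f -> ucvg F (fun t x => u t x `^ a) (fun x => f x `^ a).
Proof.
move=> c0 fcM uf e e0; have c20 : 0 < c / 2 by rewrite divr_gt0.
have [K K0 KP] := @powR_lipschitz R a _ (M + 1) c20.
have eK : 0 < e / K by rewrite divr_gt0.
apply: filterS2 (ucvg_segment c0 fcM uf) (uf _ eK) => t ucM ut x.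
have fx : c / 2 <= f x <= M + 1.
  by have /andP[? ?] := fcM x; apply/andP; split; lra.
apply: (le_trans (KP _ _ fx (ucM x))).
by rewrite mulrC -ler_pdivlMr.
Qed.

Lemma ucvg_powR_quotient (tau : T -> R) p q (a c M Q : R) :
  0 < c -> 0 < Q -> (forall x, c <= p x <= M) -> (forall x, `|q x| <= Q) ->
  tau @ F --> 0 -> (\forall t \near F, tau t != 0) ->
  ucvg F (fun t x => (tau t)^-1 * ((p x + tau t * q x) `^ a - p x `^ a))
         (fun x => a * p x `^ (a - 1) * q x).
Proof.
move=> c0 Q0 pcM qQ tau0 taun0 e e0; have c20 : 0 < c / 2 by rewrite divr_gt0.
have [K K0 KP] := @powR_taylor1 R a _ (M + 1) c20.
have ptq : ucvg F (fun t x => p x + tau t * q x) p.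
  move=> d d0; have dQ : 0 < d / Q by rewrite divr_gt0.
  move/cvgrPdist_le: tau0 => /(_ _ dQ); apply: filterS => t.
  rewrite sub0r normrN => tauQ x; rewrite opprD addrA subrr sub0r normrN normrM.
  by rewrite -(divfK (lt0r_neq0 Q0) d) ler_pM.
(* Once divided by tau, the Taylor remainder K |tau q|^2 is at most |tau| K Q^2, which this
   threshold brings below [e]. *)
have eK : 0 < e / (K * Q ^+ 2) by rewrite divr_gt0// mulr_gt0// exprn_gt0.
move/cvgrPdist_le: tau0 => /(_ _ eK) tau0.
apply: filterS3 (ucvg_segment c0 pcM ptq) taun0 tau0 => t pt t0.
rewrite sub0r normrN => te x.
have px : c / 2 <= p x <= M + 1.
  by have /andP[? ?] := pcM x; apply/andP; split; lra.
have pK : p x + tau t * q x - p x = tau t * q x by ring.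
have := KP _ _ (pt x) px; rewrite pK => Kx.
rewrite distrC.
have -> : (tau t)^-1 * ((p x + tau t * q x) `^ a - p x `^ a) -
    a * p x `^ (a - 1) * q x = (tau t)^-1 *
    ((p x + tau t * q x) `^ a - p x `^ a - a * p x `^ (a - 1) * (tau t * q x)).
  by field.
rewrite normrM normfV ler_pdivrMl ?normr_gt0//; apply: (le_trans Kx).
have -> : K * `|tau t * q x| ^+ 2 = `|tau t| * (`|tau t| * (K * `|q x| ^+ 2)).
  by rewrite normrM; ring.
rewrite ler_wpM2l//.
have te' : `|tau t| * (K * Q ^+ 2) <= e.
  by rewrite -ler_pdivlMr// mulr_gt0// exprn_gt0.
apply: le_trans te'; rewrite !ler_wpM2l ?(ltW K0)//.
by rewrite lerXn2r ?nnegrE// ltW.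
Qed.

(* Smooth convergence, presented as a class of convergent families stable under
   differentiation: uniform convergence of all derivatives then only requires
   the order 0 estimates. [CcvgQuotient] computes the directional derivatives
   of [p |-> p `^ a]. *)
Inductive Ccvg : (T -> R -> R) -> (R -> R) -> Prop :=
| CcvgBase u f of (\forall t \near F, Cinf (u t)) & Cinf f &
    (forall n, ucvg F (fun t => (u t)^`(n)) f^`(n)) : Ccvg u f
| CcvgEq u v f g of Ccvg u f & (\forall t \near F, u t = v t) & f = g :
    Ccvg v g
| CcvgAdd u v f g of Ccvg u f & Ccvg v g :
    Ccvg (fun t x => u t x + v t x) (fun x => f x + g x)
| CcvgMul u v f g of Ccvg u f & Ccvg v g :
    Ccvg (fun t x => u t x * v t x) (fun x => f x * g x)
| CcvgCst (tau : T -> R) (l : R) of tau @ F --> l :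
    Ccvg (fun t => fun=> tau t) (fun=> l)
| CcvgPow u f a of Ccvg u f & (forall x, 0 < f x) :
    Ccvg (fun t x => u t x `^ a) (fun x => f x `^ a)
| CcvgQuotient (tau : T -> R) p q a of Cinf p & Cinf q & (forall x, 0 < p x) &
    tau @ F --> 0 & (\forall t \near F, tau t != 0) :
    Ccvg (fun t x => (tau t)^-1 * ((p x + tau t * q x) `^ a - p x `^ a))
         (fun x => a * p x `^ (a - 1) * q x).

Lemma Ccvg_const p : Cinf p -> Ccvg (fun=> p) p.
Proof.
move=> Cp; apply: CcvgBase => //; first exact: nearW.
by move=> n e e0; apply: nearW => t x; rewrite subrr normr0 ltW.
Qed.

(** The four conclusions need a joint induction: the derivative of a product or power involves the
    undifferentiated families as well, computing the derivative of [u t] needs its smoothness, and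
    the uniform estimates need the bounds that [Cinf f] gives. *)
Lemma Ccvg_derive u f : Ccvg u f ->
  [/\ Cinf f, \forall t \near F, Cinf (u t), ucvg F u f &
      Ccvg (fun t => (u t)^`()) f^`()].
Proof.
elim=> {u f}.
- move=> u f Cu Cf uf; split => //; first exact: (uf 0).
  apply: CcvgBase; first by apply: filterS Cu => t; exact: Cinf_derive1.
    exact: Cinf_derive1.
  move=> n; rewrite -derive1Sn; apply: ucvg_near_eq (uf n.+1).
  by apply: nearW => t; rewrite derive1Sn.
- move=> u v f _ _ [Cf Cu uf duf] uv <-; split => //.
  + by apply: filterS2 uv Cu => t ->.
  + exact: ucvg_near_eq uf.
  + by apply: CcvgEq duf _ erefl; apply: filterS uv => t ->.
- move=> u v f g _ [Cf Cu uf duf] _ [Cg Cv vg dvg]; split.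
  + exact: CinfD.
  + by apply: filterS2 Cu Cv => t; exact: CinfD.
  + exact: ucvgD.
  + apply: CcvgEq (CcvgAdd duf dvg) _ _.
      apply: filterS2 Cu Cv => t [su _] [sv _].
      apply/esym/derive1_is_derive => x.
      by apply: is_deriveD; exact: smooth_is_derive.
    apply/esym/derive1_is_derive => x.
    by apply: is_deriveD; apply: smooth_is_derive; [case: Cf | case: Cg].
- have dM f g : Cinf f -> Cinf g ->
      (fun x => f x * derive1 g x + g x * derive1 f x) = (fun x => f x * g x)^`().
    move=> [sf _] [sg _]; apply/esym/derive1_is_derive => x.
    by apply: is_deriveM; exact: smooth_is_derive.
  move=> u v f g uf' [Cf Cu uf duf] vg' [Cg Cv vg dvg]; split.
  + exact: CinfM.
  + by apply: filterS2 Cu Cv => t; exact: CinfM.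
  + have [M M0 fM] := Cinf_bounded Cf; have [N N0 gN] := Cinf_bounded Cg.
    exact: (ucvgM M0 N0).
  + apply: CcvgEq (CcvgAdd (CcvgMul uf' dvg) (CcvgMul vg' duf)) _ _.
      by apply: filterS2 Cu Cv => t; exact: dM.
    exact: dM.
- move=> tau l taul; have dC (k : R) : (fun=> k)^`() = (fun=> 0 : R) :> (R -> R).
    by apply: derive1_is_derive => x; exact: is_derive_cst.
  split.
  + exact: Cinf_cst.
  + by apply: nearW => t; exact: Cinf_cst.
  + exact: ucvg_cst.
  + rewrite dC; apply: CcvgEq (Ccvg_const (Cinf_cst 0)) _ erefl.
    by apply: nearW => t; rewrite dC.
- have dP f a : Cinf f -> (forall x, 0 < f x) ->
      (fun x => a * f x `^ (a - 1) * derive1 f x) = (fun x => f x `^ a)^`().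
    move=> [sf _] f0; apply/esym/derive1_is_derive => x.
    by apply: is_derive_powR_comp => //; exact: smooth_is_derive.
  move=> u f a uf' [Cf Cu uf duf] f0.
  have [c c0 cf] := Cinf_lower_bound Cf f0.
  have [M M0 fM] := Cinf_bounded Cf.
  have fcM x : c <= f x <= M by rewrite cf (le_trans (ler_norm _)).
  have u0 : \forall t \near F, forall x, 0 < u t x.
    apply: filterS (ucvg_segment c0 fcM uf) => t uc x.
    by have /andP[] := uc x; lra.
  split.
  + exact: Cinf_powR.
  + by apply: filterS2 Cu u0 => t; exact: Cinf_powR.
  + exact: ucvg_powR c0 fcM uf.
  + have aa : (fun=> a) @ F --> a by exact: cvg_cst.
    apply: CcvgEq (CcvgMul (CcvgMul (CcvgCst aa) (CcvgPow (a - 1) uf' f0)) duf) _ _.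
      by apply: filterS2 Cu u0 => t; exact: dP.
    exact: dP.
- move=> tau p q a Cp Cq p0 tau0 taun0.
  have [c c0 cp] := Cinf_lower_bound Cp p0.
  have [M M0 pM] := Cinf_bounded Cp.
  have [Q Q0 qQ] := Cinf_bounded Cq.
  have pcM x : c <= p x <= M by rewrite cp (le_trans (ler_norm _)).
  have [sp _] := Cp; have [sq _] := Cq.
  have aa : (fun=> a) @ F --> a by exact: cvg_cst.
  have Cptq k : Cinf (fun x => p x + k * q x).
    by apply: CinfD => //; apply: CinfM => //; exact: Cinf_cst.
  have ptq : Ccvg (fun t x => p x + tau t * q x) (fun x => p x + 0 * q x).
    apply: CcvgAdd; first exact: Ccvg_const.
    by apply: CcvgMul; [exact: CcvgCst | exact: Ccvg_const].
  have p00 x : 0 < p x + 0 * q x by rewrite mul0r addr0.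
  have ptq0 : \forall t \near F, forall x, 0 < p x + tau t * q x.
    (* With |tau| below this threshold, |tau q| <= c / 2, so p + tau q stays above c / 2. *)
    have Qc : 0 < c / 2 / Q by rewrite !divr_gt0.
    move/cvgrPdist_le: (tau0) => /(_ _ Qc); apply: filterS => t.
    rewrite sub0r normrN => tQ x.
    have : `|tau t * q x| <= c / 2.
      by rewrite normrM -(divfK (lt0r_neq0 Q0) (c / 2)) ler_pM.
    by rewrite ler_norml; have := cp x => ? /andP[]; lra.
  have dp (x : R) := smooth_is_derive x sp; have dq (x : R) := smooth_is_derive x sq.
  split.
  + apply: CinfM => //; apply: CinfM; first exact: Cinf_cst.
    exact: Cinf_powR.
  + apply: filterS ptq0 => t pt0; apply: CinfM; first exact: Cinf_cst.
    apply: CinfD; first exact: Cinf_powR.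
    have -> : (fun x => - (p x `^ a)) = (fun x => -1 * p x `^ a).
      by apply/funext => x; rewrite mulN1r.
    by apply: CinfM; [exact: Cinf_cst | exact: Cinf_powR].
  + exact: ucvg_powR_quotient c0 Q0 pcM qQ tau0 taun0.
  (* Differentiating the quotient of exponent a gives a times the quotient of exponent a - 1 times
     p', plus a (p + tau q)^(a-1) q'. Both terms belong to the class again, so the induction
     closes. *)
  + apply: CcvgEq (CcvgAdd
      (CcvgMul (CcvgMul (CcvgCst aa) (CcvgQuotient (a - 1) Cp Cq p0 tau0 taun0))
               (Ccvg_const (Cinf_derive1 Cp)))
      (CcvgMul (CcvgMul (CcvgCst aa) (CcvgPow (a - 1) ptq p00))
               (Ccvg_const (Cinf_derive1 Cq)))) _ _.
      apply: filterS2 ptq0 taun0 => t pt0 t0.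
      apply/esym/derive1_is_derive => x.
      have dpt : is_derive x 1 (fun y => p y + tau t * q y)
          (derive1 p x + tau t * derive1 q x).
        exact: is_deriveD.
      have d1 := @is_derive_powR_comp _ (fun y => p y + tau t * q y) a x _
        (pt0 x) dpt.
      have d2 := is_derive_powR_comp a (p0 x) (dp x).
      apply: (is_derive_eq (is_deriveZ (tau t)^-1 (is_deriveB d1 d2))).
      by rewrite /GRing.scale /=; field.
    apply/esym/derive1_is_derive => x.
    have d2 := is_derive_powR_comp (a - 1) (p0 x) (dp x).
    apply: (is_derive_eq (is_deriveM (is_deriveZ a d2) (dq x))).
    rewrite /GRing.scale /= mul0r addr0.
    change (a *: p x `^ (a - 1)) with (a * p x `^ (a - 1)).
    by ring.
Qed.

Lemma Ccvg_derive1n u f n : Ccvg u f -> ucvg F (fun t => (u t)^`(n)) f^`(n).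
Proof.
elim: n u f => [|n IH] u f /Ccvg_derive[_ _ uf duf]; first exact: uf.
rewrite derive1Sn; have := IH _ _ duf; apply: ucvg_near_eq.
by apply: nearW => t; rewrite derive1Sn.
Qed.

End UniformConvergence.

(** * Convergence in the C^infty topology *)

Lemma cvg_initial (S : choiceType) (V : topologicalType) (w : S -> V) (T : Type)
    (F : set_system T) (FF : Filter F) (u : T -> S) (s : S) :
  (fun t => w (u t)) @ F --> w s -> u @ F --> (s : initial_topology w).
Proof.
move=> cF U; rewrite nbhsE => -[A [[W oW <-] Ws] AU].
have /cF FW : nbhs (w s) W by exact: open_nbhs_nbhs.
suff : F (u @^-1` U) by [].
apply: (@filterS _ F _ _ _ _ FW) => t; exact: AU.
Qed.

Lemma cvg_ptws (I : eqType) (V : topologicalType) (T : Type)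
    (F : set_system T) (FF : Filter F) (u : T -> {ptws I -> V})
    (s : {ptws I -> V}) :
  (u @ F --> s) <-> forall i, (fun t => u t i) @ F --> s i.
Proof.
split=> [us i|us].
  exact: (cvg_comp _ _ us (@proj_continuous I (fun=> V) i s)).
by apply/cvg_sup => i; apply: (@cvg_initial _ _ (fun f : I -> V => f i)) => //; exact: us.
Qed.

Lemma cvg_uniform_le (R : realType) (T : Type) (F : set_system T)
    (FF : Filter F) (u : T -> {uniform R -> R}) (f : {uniform R -> R}) :
  (u @ F --> f) <-> ucvg F u f.
Proof.
split=> [uf e e0|uf U /uniform_nbhs[E [entE EU]]].
  apply: (uf [set g : R -> R | forall x, `|f x - g x| <= e]).
  apply/uniform_nbhs; exists [set xy | ball xy.1 e xy.2]; split.
    by rewrite -entourage_ballE; exists e.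
  by move=> g fg x; have := fg x I; rewrite /ball /= => /ltW.
move: entE; rewrite -entourage_ballE => -[e /= e0 eE].
have e20 : 0 < e / 2 by rewrite divr_gt0.
suff : F (u @^-1` U) by [].
apply: (@filterS _ F _ _ _ _ (uf _ e20)) => t ut; apply: EU => x _; apply: eE => /=.
by rewrite /ball /=; apply: le_lt_trans (ut x) _; lra.
Qed.

(** The topology is initial for [jets], whose target is a product of uniform topologies, so
    convergence is tested one derivative at a time. Every topological statement below passes through
    this equivalence. *)
Lemma cvg_cinf (R : realType) (T : Type) (F : set_system T) (FF : Filter F)
    (u : T -> cinf_top R) (f : cinf_top R) :
  (u @ F --> f) <->
  forall n, ucvg F (fun t => (u t : R -> R)^`(n)) (f : R -> R)^`(n).
Proof.
split=> [uf n|uf].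
  apply/cvg_uniform_le.
  have jc := @initial_continuous _ _ (@jets R) f.
  exact: (cvg_comp _ _ (cvg_comp _ _ uf jc)
    (@proj_continuous _ (fun=> {uniform R -> R}) n (jets f))).
by apply: (@cvg_initial _ _ (@jets R)); apply/cvg_ptws => n; apply/cvg_uniform_le/uf.
Qed.

(** Order 0 already separates points. Uniqueness of limits identifies directional derivatives in
    [Phi_immersion]. *)
Lemma cinf_hausdorff (R : realType) (T : Type) (F : set_system T)
    {FF : ProperFilter F} (u : T -> cinf_top R) (f g : cinf_top R) :
  u @ F --> f -> u @ F --> g -> f = g.
Proof.
move=> /cvg_cinf/(_ 0%N) uf /cvg_cinf/(_ 0%N) ug.
apply/funext => x; apply/eqP; rewrite -subr_eq0 -normr_le0; apply/ler_addgt0Pl => e e0.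
have e20 : 0 < e / 2 by rewrite divr_gt0.
have [t [/(_ x) ft /(_ x) gt]] := filter_ex (filterI (uf _ e20) (ug _ e20)).
rewrite addr0 (splitr e) (le_trans _ (lerD ft gt))//.
by rewrite [`|g x - _|]distrC (le_trans _ (ler_normD _ _))// addrA subrK.
Qed.

Lemma Ccvg_cvg (R : realType) (T : Type) (F : set_system T) (FF : Filter F)
    (u : T -> cinf_top R) (f : cinf_top R) : Ccvg F u f -> u @ F --> f.
Proof. by move=> uf; apply/cvg_cinf => n; exact: Ccvg_derive1n. Qed.

Lemma Ccvg_prod (R : realType) (T : Type) (F : set_system T) (FF : Filter F)
    (I : Type) (s : seq I) (u : I -> T -> R -> R) (f : I -> R -> R) :
  (forall i, Ccvg F (u i) (f i)) ->
  Ccvg F (fun t x => \prod_(i <- s) u i t x) (fun x => \prod_(i <- s) f i x).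
Proof.
move=> uf; elim: s => [|i s IH].
  apply: CcvgEq (Ccvg_const (Cinf_cst 1)) _ _.
    by apply: nearW => t; apply/funext => x; rewrite big_nil.
  by apply/funext => x; rewrite big_nil.
apply: CcvgEq (CcvgMul (uf i) IH) _ _.
  by apply: nearW => t; apply/funext => x; rewrite big_cons.
by apply/funext => x; rewrite big_cons.
Qed.

Lemma Cinf_prod (R : realType) (I : Type) (s : seq I) (f : I -> R -> R) :
  (forall i, Cinf (f i)) -> Cinf (fun x => \prod_(i <- s) f i x).
Proof.
move=> Cf; elim: s => [|i s IH].
  rewrite (_ : (fun _ => _) = fun=> 1); first exact: Cinf_cst.
  by apply/funext => x; rewrite big_nil.
rewrite (_ : (fun x => _) = fun x => f i x * \prod_(j <- s) f j x).
  exact: CinfM.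
by apply/funext => x; rewrite big_cons.
Qed.

(** * The iterated differentials of Phi *)

Lemma Diff_derive1_Cinf (R : realType) (phi : cinf_top R) :
  Diff phi -> Cinf (phi : R -> R)^`().
Proof.
by move=> [sphi phi1 _ _]; split; [exact: smooth_derive1 | exact: derive1_shift1 phi1].
Qed.

Lemma Ccvg_derive1 (R : realType) (T : Type) (F : set_system T)
    (FF : Filter F) (u : T -> cinf_top R) (f : cinf_top R) :
  (\forall t \near F, Cinf (u t : R -> R)^`()) -> Cinf (f : R -> R)^`() ->
  u @ F --> f -> Ccvg F (fun t => (u t : R -> R)^`()) (f : R -> R)^`().
Proof.
move=> Cu Cf /cvg_cinf uf; apply: CcvgBase => // n.
rewrite -derive1Sn; apply: ucvg_near_eq (uf n.+1).
by apply: nearW => t; rewrite derive1Sn.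
Qed.

(** The coefficient that [k] differentiations of p^b bring out in front of p^(b-k). *)
Definition falling (R : realType) (b : R) (k : nat) : R :=
  \prod_(j < k) (b - j%:R).

(* The [k]-th differential of [Phi r] at [x], applied to [h]. *)
Definition Phi_diff (R : realType) (r : R) (k : nat) (x : cinf_top R)
    (h : {ptws 'I_k -> cinf_top R}) : cinf_top R :=
  fun y : R => r * falling r^-1 k * derive1 (x : R -> R) y `^ (r^-1 - k%:R) *
    \prod_(i < k) derive1 (h i : R -> R) y.

Lemma Phi_diff0 (R : realType) (r : R) x h : @Phi_diff R r 0 x h = Phi r x.
Proof.
by apply/funext => y; rewrite /Phi_diff /falling !big_ord0 subr0 !mulr1.
Qed.

Lemma Phi_diff_Cinf (R : realType) (r : R) (k : nat) (x : cinf_top R)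
    (h : {ptws 'I_k -> cinf_top R}) :
  Diff x -> (forall i, Cinf (h i)) -> Cinf (Phi_diff r x h).
Proof.
move=> Dx Ch; have [_ _ x0 _] := Dx.
apply: CinfM; last by apply: Cinf_prod => i; exact: Cinf_derive1.
by apply: CinfM; [exact: Cinf_cst | apply: Cinf_powR => //; exact: Diff_derive1_Cinf].
Qed.

(** The foot point enters only through the power of x', so the difference quotient is one of
    [CcvgQuotient] times fixed factors. In the limit the exponent 1/r - k becomes the last factor of
    [falling], and the derivative of the new direction [h ord0] becomes the first factor of the
    product. *)
Lemma Phi_diff_dderiv (R : realType) (r : R) (k : nat) (x : cinf_top R)
    (h : {ptws 'I_k.+1 -> cinf_top R}) :
  Diff x -> (forall i, Cinf (h i)) ->
  has_dderiv (fun y => Phi_diff r y (fun i => h (lift ord0 i))) x (h ord0)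
    (Phi_diff r x h).
Proof.
move=> Dx Ch; have [sx _ x0 _] := Dx.
have Cdx := Diff_derive1_Cinf Dx.
have Cdh i : Cinf (h i : R -> R)^`() by exact: Cinf_derive1.
have cc (c : R) : (fun=> c) @ (0 : R)^' --> c by exact: cvg_cst.
apply: Ccvg_cvg.
have t0 : (id : R -> R) @ (0 : R)^' --> (0 : R) by exact: cvg_within.
have tn0 : \forall t \near (0 : R)^', (t : R) != 0 by exact: nbhs_dnbhs_neq.
apply: CcvgEq (CcvgMul (CcvgMul (CcvgCst (cc (r * falling r^-1 k)))
   (CcvgQuotient (r^-1 - k%:R) Cdx (Cdh ord0) x0 t0 tn0))
   (Ccvg_const (Cinf_prod (index_enum 'I_k) (fun i => Cdh (lift ord0 i))))) _ _.
  apply: nearW => t; apply/funext => y.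
  have -> : (t^-1 *: (Phi_diff r (x + t *: h ord0) (fun i => h (lift ord0 i)) -
      Phi_diff r x (fun i => h (lift ord0 i))) : cinf_top R) y = t^-1 *
      (Phi_diff r (x + t *: h ord0) (fun i => h (lift ord0 i)) y -
      Phi_diff r x (fun i => h (lift ord0 i)) y) by [].
  have dxth : derive1 (x + t *: h ord0 : R -> R) =
      (fun y => derive1 (x : R -> R) y + t * derive1 (h ord0 : R -> R) y).
    apply: derive1_is_derive => z.
    have dh : is_derive z 1 (h ord0 : R -> R) (derive1 (h ord0 : R -> R) z).
      by apply: smooth_is_derive; case: (Ch ord0).
    exact: (is_deriveD (smooth_is_derive z sx) (is_deriveZ t dh)).
  by rewrite /Phi_diff dxth; ring.
apply/funext => y; rewrite /Phi_diff /falling big_ord_recr big_ord_recl /=.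
rewrite -natr1 opprD addrA; ring.
Qed.

(** [Phi_diff] is a finite product of a constant, a power of x' and the derivatives of the
    directions, each convergent in the class [Ccvg]. The trace filter guarantees that the nearby
    derivatives are smooth and periodic, as [CcvgBase] demands. *)
Lemma Phi_diff_continuous (R : realType) (r : R) (k : nat) :
  {within @Diff0 R `*` [set h : {ptws 'I_k -> cinf_top R} |
      forall i, Cinf0 (h i)],
    continuous (fun p : cinf_top R * {ptws 'I_k -> cinf_top R} =>
      Phi_diff r p.1 p.2)}.
Proof.
apply/subspace_continuousP => -[x h] [[Dx _] /= Ch].
set S := _ `*` _; have [_ _ x0 _] := Dx.
apply: Ccvg_cvg.
have cfst : fst @ within S (nbhs (x, h)) --> x.
  move=> A xA; apply: (@cvg_within _ (nbhs (x, h)) _ S (fst @^-1` A)).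
  exact: (cvg_fst xA).
have csnd : snd @ within S (nbhs (x, h)) --> h.
  move=> A hA; apply: (@cvg_within _ (nbhs (x, h)) _ S (snd @^-1` A)).
  exact: (cvg_snd hA).
have WS : \forall p \near within S (nbhs (x, h)), S p by exact: withinT.
apply: CcvgMul.
  apply: CcvgMul; first by apply: CcvgCst; exact: cvg_cst.
  apply: CcvgPow => //; apply: Ccvg_derive1 => //.
    by apply: filterS WS => p [[Dp _] _]; exact: Diff_derive1_Cinf.
  exact: Diff_derive1_Cinf.
apply: Ccvg_prod => i; apply: Ccvg_derive1.
- by apply: filterS WS => p [_ /(_ i)[Cp _]]; exact: Cinf_derive1.
- by apply: Cinf_derive1; case: (Ch i).
- by move/cvg_ptws: csnd => /(_ i).
Qed.

Lemma Phi_smooth_map (R : realType) (r : R) :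
  smooth_map (@Diff0 R) (@Cinf0 R) (@Cinf R) (Phi r).
Proof.
exists (fun k x h => Phi_diff r x h); split.
- by move=> x h _; exact: Phi_diff0.
- by move=> k x h [Dx _] Ch; apply: Phi_diff_Cinf => // i; case: (Ch i).
- by move=> k x h [Dx _] Ch; apply: Phi_diff_dderiv => // i; case: (Ch i).
- by move=> k; exact: Phi_diff_continuous.
Qed.

Lemma Phi_dderiv (R : realType) (r : R) (x h : cinf_top R) : 0 < r ->
  Diff x -> Cinf h ->
  has_dderiv (Phi r) x h
    (fun y => derive1 (x : R -> R) y `^ (r^-1 - 1) * derive1 (h : R -> R) y).
Proof.
move=> r0 Dx Ch.
have := @Phi_diff_dderiv R r 0 x (fun=> h) Dx (fun=> Ch).
have -> : (fun y => @Phi_diff R r 0 y (fun=> h)) = Phi r.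
  by apply/funext => y; exact: Phi_diff0.
suff -> : @Phi_diff R r 1 x (fun=> h) =
  (fun y => derive1 (x : R -> R) y `^ (r^-1 - 1) * derive1 (h : R -> R) y) by [].
apply/funext => y; rewrite /Phi_diff /falling !big_ord_recl !big_ord0.
by rewrite subr0 !mulr1 mulfV ?mul1r// gt_eqF.
Qed.

(* The library's [integral0] is a lemma. *)
Local Notation integral0 := Defs.integral0.

(** * Oriented integrals and primitives *)

(** Zeros of [f] have to be allowed, since the isometry applies this to X', which vanishes somewhere
    by periodicity of X. There continuity is checked by hand, with |z| < e^(1/r) giving |z|^r <
    e. *)
Lemma continuous_normr_powR (R : realType) (f : R -> R) (r : R) :
  0 < r -> continuous f -> continuous (fun x => `|f x| `^ r).
Proof.
move=> r0 cf x; apply: (@continuous_comp _ _ _ f (fun z : R => `|z| `^ r)).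
  exact: cf.
have [->|z0] := eqVneq (f x) 0; last first.
  have fx0 : 0 < `|f x| by rewrite normr_gt0.
  apply: (@continuous_comp _ _ _ (fun z : R => `|z|) (@powR R ^~ r)).
    exact: norm_continuous.
  apply/differentiable_continuous/derivable1_diffP.
  by have [] := is_derive1_powR r fx0.
apply/cvgrPdist_lt => e e0; rewrite normr0 powR0 ?gt_eqF//.
have d0 : 0 < e `^ r^-1 by exact: powR_gt0.
apply/nbhs_ballP; exists (e `^ r^-1) => //= z.
rewrite /ball /= sub0r normrN => ze.
rewrite sub0r normrN ger0_norm ?powR_ge0//.
rewrite -[ltRHS](powRr1 (ltW e0)) -(mulVf (lt0r_neq0 r0)) powRrM.
by rewrite gt0_ltr_powR ?nnegrE ?powR_ge0.
Qed.

Lemma continuous_integrable_itv (R : realType) (g : R -> R) (a b : R) :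
  continuous g -> lebesgue_measure.-integrable `[a, b] (EFin \o g).
Proof.
move=> cg; apply: continuous_compact_integrable; first exact: segment_compact.
exact: continuous_subspaceT.
Qed.

Lemma Rintegral_itv_add (R : realType) (g : R -> R) (a b c : R) :
  continuous g -> a <= b -> b <= c ->
  \int[lebesgue_measure]_(t in `[a, c]) g t =
  \int[lebesgue_measure]_(t in `[a, b]) g t +
  \int[lebesgue_measure]_(t in `[b, c]) g t.
Proof.
move=> cg ab bc; apply/eqP; rewrite addrC -subr_eq; apply/eqP/esym.
rewrite -(@Rintegral_itv_obnd_cbnd _ b (BRight c)).
  rewrite -(@Rintegral_itvB _ _ (BLeft a) (BRight c) b) ?bnd_simp//.
  exact: continuous_integrable_itv.
apply: integrableS (continuous_integrable_itv b c cg) => //.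
by apply: subset_itvr; rewrite bnd_simp.
Qed.

(** A base point to the left of both 0 and [y] removes the case distinction on the sign of [y], so
    the fundamental theorem with fixed left end applies also around 0. *)
Lemma integral0E (R : realType) (g : R -> R) (a y : R) :
  continuous g -> a <= 0 -> a <= y ->
  integral0 g y = \int[lebesgue_measure]_(t in `[a, y]) g t -
                  \int[lebesgue_measure]_(t in `[a, 0]) g t.
Proof.
move=> cg a0 ay; rewrite /integral0; case: (lerP 0 y) => [y0|/ltW y0].
  by rewrite (Rintegral_itv_add cg a0 y0) addrC addKr.
by rewrite (Rintegral_itv_add cg ay y0) opprD addNKr.
Qed.

Lemma is_derive_integral0 (R : realType) (g : R -> R) (x : R) :
  continuous g -> is_derive x 1 (integral0 g) (g x).
Proof.
move=> cg; pose a := Num.min x 0 - 1.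
have a0 : a < 0 by rewrite /a ltrBlDr gt_min add0r ltr01 orbT.
have ax : a < x by rewrite /a ltrBlDr gt_min ltrDl ltr01.
pose G y := \int[lebesgue_measure]_(t in `[a, y]) g t.
have [dG GE] : derivable G x 1 /\ G^`() x = g x.
  apply: (@continuous_FTC1_closed _ g a x (x + 1)) => //.
  - by rewrite ltrDl.
  - exact: continuous_integrable_itv.
  - exact: cg.
have : is_derive x 1 (fun y => G y - G 0) (g x - 0).
  have dGx : is_derive x 1 G (g x) by apply: (DeriveDef dG); rewrite -derive1E.
  exact: (is_deriveB dGx (is_derive_cst (G 0) x 1)).
rewrite subr0; apply: near_eq_is_derive; near=> y.
by rewrite (integral0E cg (ltW a0)) //; apply/ltW; near: y; exact: lt_nbhsr.
Unshelve. all: by end_near. Qed.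

Lemma integral0_0 (R : realType) (g : R -> R) : integral0 g 0 = 0.
Proof. by rewrite /integral0 lexx set_itv1 Rintegral_set1. Qed.

Lemma integral0_1 (R : realType) (g : R -> R) :
  integral0 g 1 = \int[lebesgue_measure]_(x in `[0, 1]) g x.
Proof. by rewrite /integral0 ler01. Qed.

Lemma is_derive_eq_fun (R : realType) (f g df : R -> R) (a : R) :
  (forall x : R, is_derive x 1 f (df x)) ->
  (forall x : R, is_derive x 1 g (df x)) -> f a = g a -> f = g.
Proof.
move=> fP gP fga; apply/funext => x; apply/eqP; rewrite -subr_eq0; apply/eqP.
have fg0 (y : R) : is_derive y 1 (fun x => f x - g x) 0.
  by rewrite -(subrr (df y)); exact: is_deriveB.
by rewrite (is_derive_0_is_cst x a fg0) fga subrr.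
Qed.

(** Two primitives that agree at 0 are equal. Besides evaluating integrals, this acts as the
    substitution rule in [Phi_isometric]. *)
Lemma integral0_is_derive (R : realType) (g G : R -> R) : continuous g ->
  (forall x : R, is_derive x 1 G (g x)) -> G 0 = 0 -> integral0 g = G.
Proof.
move=> cg dG G0; apply: (@is_derive_eq_fun _ _ _ g 0) => //.
  by move=> x; exact: is_derive_integral0.
by rewrite integral0_0.
Qed.

(** * Phi, its inverse and its image *)

Lemma Diff0_1 (R : realType) (phi : cinf_top R) : Diff0 phi -> phi 1 = 1.
Proof. by move=> [[_ /(_ 0) + _ _] phi0]; rewrite !add0r phi0 add0r. Qed.

Lemma normr_Phi_powR (R : realType) (r : R) (phi : cinf_top R) (x : R) :
  0 < r -> 0 < derive1 (phi : R -> R) x ->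
  `|Phi r phi x| `^ r = r `^ r * derive1 (phi : R -> R) x.
Proof.
move=> r0 dphi0; rewrite /Phi ger0_norm ?mulr_ge0 ?powR_ge0 ?ltW//.
by rewrite powRM ?powR_ge0 ?ltW// -powRrM mulVf ?gt_eqF// powRr1// ltW.
Qed.

Lemma Phi_Cinf (R : realType) (r : R) (phi : cinf_top R) :
  Diff phi -> Cinf (Phi r phi).
Proof.
move=> Dphi; have [_ _ phi0 _] := Dphi.
apply: (@CinfM _ (fun=> r)); first exact: Cinf_cst.
by apply: Cinf_powR => //; exact: Diff_derive1_Cinf.
Qed.

Lemma Phi_gt0 (R : realType) (r : R) (phi : cinf_top R) (x : R) :
  0 < r -> Diff phi -> 0 < Phi r phi x.
Proof. by move=> r0 [_ _ phi0 _]; rewrite /Phi mulr_gt0// powR_gt0. Qed.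

Lemma integral0_Phi (R : realType) (r : R) (phi : cinf_top R) :
  0 < r -> Diff0 phi ->
  integral0 (fun t => `|Phi r phi t| `^ r) = (fun x => r `^ r * phi x).
Proof.
move=> r0 [Dphi phi0]; have [sphi _ dphi0 _] := Dphi.
apply: integral0_is_derive; last by rewrite phi0 mulr0.
  apply: continuous_normr_powR => //; apply: smooth_continuous.
  by have [] := Phi_Cinf r Dphi.
move=> x; rewrite normr_Phi_powR//.
exact: (is_deriveZ (r `^ r) (smooth_is_derive x sphi)).
Qed.

Lemma Phi_invK (R : realType) (r : R) (phi : cinf_top R) :
  0 < r -> Diff0 phi -> Phi_inv r (Phi r phi) = phi.
Proof.
move=> r0 Dphi; apply/funext => x; rewrite /Phi_inv integral0_Phi// mulKf//.
by rewrite gt_eqF// powR_gt0.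
Qed.

Lemma Lr_norm_Phi (R : realType) (r : R) (phi : cinf_top R) :
  0 < r -> Diff0 phi -> Lr_norm r (Phi r phi) = r.
Proof.
move=> r0 Dphi; rewrite /Lr_norm -integral0_1 integral0_Phi// Diff0_1// mulr1.
by rewrite -powRrM mulfV ?gt_eqF// powRr1// ltW.
Qed.

Lemma smooth_of_is_derive (R : realType) (f df : R -> R) :
  (forall x : R, is_derive x 1 f (df x)) -> smooth df -> smooth f.
Proof.
move=> dP sdf [|n] x; first by have [] := dP x.
by rewrite derive1Sn (derive1_is_derive dP); exact: sdf.
Qed.

(** The positive derivative gives injectivity, and f(x + n) = f(x) + n makes [f] unbounded in both
    directions, so the intermediate value theorem gives surjectivity. *)
Lemma Diff_of_derive_gt0 (R : realType) (f : R -> R) : smooth f ->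
  (forall x, f (x + 1) = f x + 1) -> (forall x, 0 < derive1 f x) -> Diff f.
Proof.
move=> sf f1 f0; have cf := smooth_continuous sf; split => //.
have incr x y : x < y -> f x < f y.
  move=> xy; apply: (@gtr0_derive1_incr _ f x y) => //.
  - by move=> z _; exact: (sf 0).
  - exact: continuous_subspaceT.
have fnat n x : f (x + n%:R) = f x + n%:R.
  by elim: n => [|n IH]; rewrite ?addr0// -natr1 !addrA f1 IH.
have surj y : exists x, f x = y.
  (* An integer larger than |y - f(0)|, so that y lies between f(-n) = f(0) - n and f(n) = f(0) +
     n. *)
  pose n := (Num.truncn (`|y - f 0|)).+1.
  have yn : `|y - f 0| < n%:R by exact: truncnS_gt.
  have nn : (- n%:R : R) <= n%:R by rewrite ge0_cp.
  have fn : f n%:R = f 0 + n%:R by rewrite -fnat add0r.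
  have fNn : f (- n%:R) = f 0 - n%:R.
    by apply/eqP; rewrite eq_sym subr_eq -fnat addNr.
  have [||x _ <-] := @IVT _ f (- n%:R) n%:R y nn; last by exists x.
    exact: continuous_subspaceT.
  rewrite fn fNn ge_min le_max; move: yn; rewrite ltr_norml => /andP[? ?].
  by apply/andP; split; apply/orP; [left | right]; lra.
have [g gK] := choice surj.
have fK : cancel f g.
  move=> x; case: (ltgtP (g (f x)) x) => // /incr; rewrite gK ltxx//.
by exists g; split => //; exact: smooth_inverse fK gK f0.
Qed.

Section PhiInv.
Context {R : realType} (r : R) (f : cinf_top R).
Context (r0 : 0 < r) (Cf : Cinf f) (f0 : forall x : R, 0 < f x).

Let powE : (fun t => `|f t| `^ r) = (fun t => f t `^ r).
Proof. by apply/funext => t; rewrite gtr0_norm. Qed.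

Lemma is_derive_Phi_inv (x : R) :
  is_derive x 1 (Phi_inv r f : R -> R) ((r `^ r)^-1 * f x `^ r).
Proof.
apply: is_deriveZ; rewrite powE; apply: is_derive_integral0.
by apply: smooth_continuous; have [] := Cinf_powR r Cf f0.
Qed.

Lemma derive1_Phi_inv : derive1 (Phi_inv r f : R -> R) =
  (fun x => (r `^ r)^-1 * f x `^ r).
Proof. exact/derive1_is_derive/is_derive_Phi_inv. Qed.

Lemma Phi_invRL : Phi r (Phi_inv r f) = f.
Proof.
apply/funext => x; rewrite /Phi derive1_Phi_inv powRM ?powR_ge0 ?invr_ge0 ?powR_ge0//.
rewrite -powRrM mulfV ?gt_eqF// powRr1 ?ltW// -powR_inv1 ?powR_ge0//.
rewrite -!powRrM mulN1r mulrN mulfV ?gt_eqF// powRN powRr1 ?ltW//.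
by rewrite mulVKf// gt_eqF.
Qed.

Lemma Phi_inv_Diff0 : Lr_norm r f = r -> Diff0 (Phi_inv r f).
Proof.
move=> nf; have rr0 : 0 < r `^ r by exact: powR_gt0.
have Phi0 : Phi_inv r f 0 = 0 by rewrite /Phi_inv integral0_0 mulr0.
(* The norm condition says I^(1/r) = r for the integral I over [0, 1], hence I = r^r, which the
   prefactor normalises to 1. *)
have Phi1 : Phi_inv r f 1 = 1.
  rewrite /Phi_inv integral0_1; move: nf; rewrite /Lr_norm.
  set I := (X in X `^ r^-1) => nI.
  have I0 : 0 <= I by apply: Rintegral_ge0 => x _; exact: powR_ge0.
  rewrite -[X in _ * X = _]/I.
  have -> : I = r `^ r by rewrite -[X in _ = X `^ _]nI -powRrM mulVf ?gt_eqF// powRr1.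
  by rewrite mulVf ?gt_eqF.
split => //; apply: Diff_of_derive_gt0.
- apply: (smooth_of_is_derive is_derive_Phi_inv).
  apply: smoothM; first exact: smooth_cst.
  by apply: smooth_powR => //; case: Cf.
(* Both sides of the translation rule have the same derivative because [f] is periodic, and they
   agree at 0 because the value at 1 is 1. *)
- move=> x; have := @is_derive_eq_fun _ (fun y => Phi_inv r f (y + 1))
    (fun y => Phi_inv r f y + 1) (fun x => (r `^ r)^-1 * f x `^ r) 0.
  move=> /(_ _ _ _)/(congr1 (@^~ x)) /=; apply.
  + move=> y; have <- := (proj2 Cf) y.
    have dy : is_derive y 1 (fun z : R => z + 1) (1 + 0) by exact: is_deriveD.
    have := @is_derive1_comp _ (Phi_inv r f : R -> R) _ y _ _
      (is_derive_Phi_inv (y + 1)) dy.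
    by rewrite addr0 mulr1.
  + move=> y; rewrite -[X in is_derive _ _ _ X]addr0.
    by apply: is_deriveD; exact: is_derive_Phi_inv.
  + by rewrite Phi0 !add0r.
- by move=> x; rewrite derive1_Phi_inv mulr_gt0 ?invr_gt0 ?powR_gt0.
Qed.

End PhiInv.

Lemma range_Phi (R : realType) (r : R) : 0 < r ->
  Phi r @` @Diff0 R =
  [set f | [/\ Cinf f, (forall x : R, 0 < f x) & Lr_norm r f = r]].
Proof.
move=> r0; apply/seteqP; split=> [_ [phi Dphi <-]|f [Cf f0 nf]] /=.
  have [D _] := Dphi; split; [exact: Phi_Cinf | move=> x; exact: Phi_gt0 |
    exact: Lr_norm_Phi].
by exists (Phi_inv r f); [exact: Phi_inv_Diff0 | exact: Phi_invRL].
Qed.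

(** * The isometry *)

Lemma Phi_isometric (R : realType) (r : R) : 0 < r -> isometric r (@Phi R r).
Proof.
move=> r0 phi h Dphi0 [X [CX X0] hE]; have [Dphi phi0] := Dphi0.
have [sphi phi1 dphi0 [psi [_ phiK psiK]]] := Dphi.
have dphi (x : R) := smooth_is_derive x sphi.
have [sX Xp] := CX; have dX (x : R) := smooth_is_derive x sX.
have dh (x : R) : is_derive x 1 (h : R -> R)
    (derive1 (X : R -> R) (phi x) * derive1 (phi : R -> R) x).
  rewrite hE; exact: is_derive1_comp (dX (phi x)) (dphi x).
have Ch : Cinf h.
  split; first by rewrite hE; exact: smooth_comp.
  by move=> x; rewrite hE /= phi1 Xp.
eexists; first exact: Phi_dderiv.
rewrite /finsler.
have -> : h \o pinv setT phi = (X : R -> R).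
  apply/funext => x; rewrite hE /=; congr (X _); apply: pinvK.
  by rewrite inE; exists (psi x).
rewrite /Lr_norm -!integral0_1; congr (_ `^ _).
have cX : continuous (fun x => `|derive1 (X : R -> R) x| `^ r).
  by apply/continuous_normr_powR/smooth_continuous/smooth_derive1.
have cphi := smooth_continuous sphi.
(* The change of variable phi, obtained from uniqueness of primitives: by the chain rule the right
   side is a primitive of the integrand on the left, and it vanishes at 0 since phi(0) = 0. *)
have dI : integral0 (fun x => `|derive1 (X : R -> R) (phi x)| `^ r *
                              derive1 (phi : R -> R) x) =
    (fun x => integral0 (fun x => `|derive1 (X : R -> R) x| `^ r) (phi x)).
  apply: integral0_is_derive; last by rewrite phi0 integral0_0.
    move=> x; apply: cvgM; last by apply: smooth_continuous; exact: smooth_derive1.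
    apply: (@continuous_comp _ _ _ (phi : R -> R)
      (fun x : R => `|derive1 (X : R -> R) x| `^ r)); last exact: cX.
    exact: cphi.
  by move=> x; exact: is_derive1_comp (is_derive_integral0 (phi x) cX) (dphi x).
(* The upper limit 1 on the right is read as phi(1), which puts that side in the form of [dI]
   evaluated at 1; a pointwise identity of integrands remains. *)
rewrite (derive1_is_derive dh) -[in RHS](Diff0_1 Dphi0).
rewrite -[RHS]/((fun x =>
  integral0 (fun x => `|derive1 (X : R -> R) x| `^ r) (phi x)) 1).
rewrite -dI; congr (integral0 _ 1).
apply/funext => x; have dx0 := dphi0 x.
rewrite mulrCA normrM (ger0_norm (mulr_ge0 (powR_ge0 _ _) (ltW dx0))).
(* Reading phi' as phi'^1 merges the two powers into phi'^(1/r), whose r-th power is phi'. *)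
rewrite -{2}(powRr1 (ltW dx0)) -powRD; last by rewrite lt0r_neq0 ?implybT.
by rewrite subrK powRM ?powR_ge0// -powRrM mulVf ?gt_eqF// powRr1// ltW.
Qed.

(** * Openness of the image in the sphere *)

Lemma cinf_nbhs_ge (R : realType) (f : cinf_top R) (e : R) : 0 < e ->
  \forall g \near f, forall x : R, `|f x - g x| <= e.
Proof.
by move=> e0; have /cvg_cinf/(_ 0%N)/(_ e e0) : id @ f --> f by exact: cvg_id.
Qed.

(** A uniform lower bound e survives as e / 2 under a perturbation of size e / 2. Pointwise
    positivity would not do: exp(-x^2) loses it under arbitrarily small constant shifts. *)
Lemma open_bounded_below (R : realType) :
  open [set f : cinf_top R | exists2 e, 0 < e & forall x : R, e <= f x].
Proof.
rewrite openE => f [e e0 fe]; have e20 : 0 < e / 2 by rewrite divr_gt0.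
apply: filterS (cinf_nbhs_ge f e20) => g fg; exists (e / 2) => // x.
by have := fe x; have := fg x; have := ler_norm (f x - g x); lra.
Qed.

Lemma range_Phi_open (R : realType) (r : R) : 0 < r ->
  Phi r @` @Diff0 R = Lr_sphere r r `&`
    [set f : cinf_top R | exists2 e, 0 < e & forall x : R, e <= f x].
Proof.
move=> r0; rewrite range_Phi//; apply/seteqP; split=> f /=.
  by move=> [Cf f0 nf]; split => //; exact: Cinf_lower_bound Cf f0.
by move=> [[Cf nf] [e e0 fe]]; split => // x; exact: lt_le_trans (fe x).
Qed.

(** * Continuity of the inverse, and injectivity of the differential *)

(** The difference of two lifts is periodic and vanishes at 0, so the mean value theorem on [0, 1]
    bounds it everywhere by the supremum of the difference of the derivatives. *)
Lemma Diff0_ucvg (R : realType) (T : Type) (F : set_system T)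
    (FF : Filter F) (u : T -> cinf_top R) (f : cinf_top R) :
  (\forall t \near F, Diff0 (u t)) -> Diff0 f ->
  ucvg F (fun t => derive1 (u t : R -> R)) (derive1 (f : R -> R)) ->
  ucvg F u f.
Proof.
move=> Du [[sf f1 _ _] f0] duf e e0.
apply: filterS2 Du (duf _ e0) => t [[su u1 _ _] u0] dut x.
have per y : (f (y + 1) - u t (y + 1) : R) = f y - u t y by rewrite f1 u1; ring.
have [y + ->] := @periodic_fundamental R (fun x => f x - u t x) per x.
rewrite in_itv /= => /andP[y0 y1].
have dd (z : R) : is_derive z 1 (fun x : R => f x - u t x : R)
    (derive1 (f : R -> R) z - derive1 (u t : R -> R) z).
  exact: (is_deriveB (smooth_is_derive z sf) (smooth_is_derive z su)).
have [|c _] := @MVT_segment R (fun x => f x - u t x) _ 0 y y0 (fun z _ => dd z).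
  apply: continuous_subspaceT => z; apply: cvgB; exact: smooth_continuous.
rewrite f0 u0 !subr0 => ->.
by rewrite normrM (ger0_norm y0) -[leRHS]mulr1 ler_pM.
Qed.

(** From order 1 on, the derivatives are those of a constant times f^r, a power of a positive
    periodic function; order 0 is recovered by [Diff0_ucvg]. *)
Lemma Phi_inv_cvg (R : realType) (r : R) (f : cinf_top R) : 0 < r ->
  (Phi r @` @Diff0 R) f ->
  Phi_inv r @ within (Phi r @` @Diff0 R) (nbhs f) --> Phi_inv r f.
Proof.
move=> r0 Uf; set F := within _ _.
have WU : \forall g \near F, (Phi r @` @Diff0 R) g by exact: withinT.
have gP : \forall g \near F,
    [/\ Cinf g, (forall x : R, 0 < g x) & Lr_norm r g = r].
  by apply: filterS WU => g; rewrite range_Phi.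
have Cg : \forall g \near F, Cinf g by apply: filterS gP => g [].
have [Cf f0 nf] : [/\ Cinf f, (forall x : R, 0 < f x) & Lr_norm r f = r].
  by move: Uf; rewrite range_Phi.
have idF : id @ F --> f by exact: cvg_within.
have gf : Ccvg F (fun g => g) f.
  by apply: CcvgBase => // n; move/cvg_cinf: idF => /(_ n).
have dgf : Ccvg F (fun g => derive1 (Phi_inv r g : R -> R))
    (derive1 (Phi_inv r f : R -> R)).
  have cc : (fun=> (r `^ r)^-1) @ F --> (r `^ r)^-1 by exact: cvg_cst.
  apply: CcvgEq (CcvgMul (CcvgCst cc) (CcvgPow r gf f0)) _ _.
    by apply: filterS gP => g [? ? _]; rewrite derive1_Phi_inv.
  by rewrite derive1_Phi_inv.
apply/cvg_cinf => -[|n]; last first.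
  rewrite derive1Sn; apply: ucvg_near_eq (Ccvg_derive1n n dgf).
  by apply: nearW => g; rewrite derive1Sn.
apply: Diff0_ucvg.
- by apply: filterS gP => g [? ? ?]; exact: Phi_inv_Diff0.
- exact: Phi_inv_Diff0.
- exact: (Ccvg_derive1n 0 dgf).
Qed.

Lemma Phi_relatively_open (R : realType) (r : R) (V : set (cinf_top R)) :
  0 < r -> open V ->
  exists2 V' : set (cinf_top R), open V' &
    Phi r @` (@Diff0 R `&` V) = Phi r @` @Diff0 R `&` V'.
Proof.
move=> r0 oV; set U := Phi r @` @Diff0 R.
(* The preimage of [V] under the inverse, enlarged by everything off [U]. Continuity of the inverse
   along [U] says precisely that the points of Phi(V) are interior to this set. *)
exists (interior [set f | U f -> V (Phi_inv r f)]); first exact: open_interior.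
apply/seteqP; split=> [_ [phi [Dphi Vphi] <-]|
  f [[phi Dphi <-] /interior_subset]].
  have Uphi : U (Phi r phi) by exists phi.
  split=> //; apply: (Phi_inv_cvg r0 Uphi).
  by rewrite Phi_invK//; exact: open_nbhs_nbhs.
rewrite /= Phi_invK// => Vphi; exists phi => //; split => //.
by apply: Vphi; exists phi.
Qed.

(** Uniqueness of limits gives phi'^(1/r - 1) h' = 0, so [h] is constant. Constants do lie in the
    kernel of the differential; the normalisation h(0) = 0 excludes the nonzero ones. *)
Lemma Phi_immersion (R : realType) (r : R) (phi h : cinf_top R) : 0 < r ->
  Diff phi -> Cinf0 h -> has_dderiv (Phi r) phi h 0 -> h = 0.
Proof.
move=> r0 Dphi [Ch h0] dPhi0; have [_ _ dphi0 _] := Dphi.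
have PF : ProperFilter (0 : R)^' by exact: Proper_dnbhs_numFieldType.
have E := @cinf_hausdorff _ _ _ PF _ _ _ dPhi0 (Phi_dderiv r0 Dphi Ch).
have dh (x : R) : is_derive x 1 (h : R -> R) 0.
  have [sh _] := Ch; have := smooth_is_derive x sh.
  suff -> : derive1 (h : R -> R) x = 0 by [].
  have /esym/eqP := congr1 (fun f : cinf_top R => (f x : R)) E.
  by rewrite mulf_eq0 gt_eqF ?powR_gt0//= => /eqP.
by apply/funext => x; rewrite (is_derive_0_is_cst x 0 dh).
Qed.

Theorem theorem3p2p1 (R : realType) (r : R) (hr : 1 <= r) :
  let U := Phi r @` @Diff0 R in
  [/\ smooth_embedding (@Diff0 R) (@Cinf0 R) (@Cinf R) (Phi r),
      isometric r (Phi r),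
      U `<=` Lr_sphere r r /\
        (exists2 O : set (cinf_top R), open O & U = Lr_sphere r r `&` O),
      U = [set f | [/\ Cinf f, (forall x : R, 0 < f x) & Lr_norm r f = r]] &
      (forall phi, Diff0 phi -> Phi_inv r (Phi r phi) = phi) /\
        (forall f, U f -> Diff0 (Phi_inv r f) /\ Phi r (Phi_inv r f) = f)].
Proof.
have r0 : 0 < r := lt_le_trans ltr01 hr.
move=> U; split.
- split; first exact: Phi_smooth_map.
  + move=> phi psi; rewrite !inE => Dphi Dpsi E.
    by rewrite -(Phi_invK r0 Dphi) E Phi_invK.
  + by move=> phi h [Dphi _] Ch; exact: Phi_immersion.
  + by move=> V; exact: Phi_relatively_open.
- exact: Phi_isometric.
- have UE := range_Phi_open r0; split.
    by rewrite /U UE; exact: subIsetl.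
  by eexists; [exact: open_bounded_below | exact: UE].
- exact: range_Phi.
- split=> [phi|f]; first exact: Phi_invK.
  rewrite /U range_Phi// => -[Cf f0 nf].
  by split; [exact: Phi_inv_Diff0 | exact: Phi_invRL].
Qed.
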